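(* If $Z$ is the configuration $\{0000,1100,1010,0110\}$ in $Q_4$, then the $4$-cube density of $Z$ is $$\lambda(Z,4)=\frac{1}{2}.$$
   Context: The $n$-cube $Q_n$ is the graph with vertex set $V_n=\{0,1\}^n$, two vertices being adjacent iff they differ in exactly one coordinate. A configuration in $Q_n$ is a subset of $V_n$. For configurations $H,K$ in $Q_d$, $K$ is an exact copy of $H$ if some graph automorphism of $Q_d$ maps $H$ onto $K$. For $1\le d\le n$, a sub-$d$-cube $R$ of $Q_n$ is obtained by letting $d$ coordinates vary and fixing the other $n-d$ coordinates; there are $\binom{n}{d}2^{n-d}$ of them, and each is identified with $Q_d$ through its $d$ varying coordinates, so it makes sense to ask whether $S\cap R$ is an exact copy of $H$. For a configuration $H$ in $Q_d$ and $S\subseteq V_n$, let $g(H,d,n,S)$ be the number of sub-$d$-cubes $R$ of $Q_n$ such that $S\cap R$ is an exact copy of $H$, divided by $\binom{n}{d}2^{n-d}$. Let $\lambda(H,d,n)=\max_{S\subseteq V_n} g(H,d,n,S)$. This is nonincreasing in $n$, and the $d$-cube density of $H$ is $\lambda(H,d)=\lim_{n\to\infty}\lambda(H,d,n)$. *)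

(* Defs.v *)
From mathcomp Require Import all_boot all_order all_fingroup all_algebra.
From mathcomp Require Import all_classical all_reals all_analysis.
Set Implicit Arguments.
Unset Strict Implicit.
Unset Printing Implicit Defensive.
Import Order.TTheory GRing.Theory Num.Theory.
Import numFieldNormedType.Exports.
Local Open Scope ring_scope.

Definition cube (n : nat) := {ffun 'I_n -> bool}.

Definition cube_adj (n : nat) : rel (cube n) :=
  fun u v => #|[set i | u i != v i]%SET| == 1%N.

Definition cube_aut (n : nat) (s : {perm cube n}) : bool :=
  [forall u, forall v, cube_adj (s u) (s v) == cube_adj u v].

Definition exact_copy (d : nat) (H K : {set cube d}) : bool :=
  [exists s : {perm cube d}, cube_aut s && (s @: H == K)%SET].

(* A subcube is encoded by its pattern: [f i = None] if the coordinate [i]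
   varies, and [f i = Some b] if it is fixed to [b]. Distinct patterns define
   distinct subcubes, so counting patterns is counting subcubes. *)
Definition pattern (n : nat) := {ffun 'I_n -> option bool}.

Definition varying (n : nat) (f : pattern n) : {set 'I_n} :=
  [set i | f i == None]%SET.

Definition subcube (n : nat) (f : pattern n) : {set cube n} :=
  [set v : cube n | [forall i, (i \in varying f) || (f i == Some (v i))]]%SET.

(* The varying coordinates are read in increasing order. When
   [#|varying f| = d], the default value of [nth] is never reached. *)
Definition to_cube (d n : nat) (f : pattern n) (v : cube n) : cube d :=
  [ffun k : 'I_d => nth false [seq v i | i <- enum (varying f)] k].

Definition trace_on (d n : nat) (S : {set cube n}) (f : pattern n) :
    {set cube d} :=
  (to_cube d f @: (S :&: subcube f))%SET.

Definition copies (d n : nat) (H : {set cube d}) (S : {set cube n}) :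
    {set pattern n} :=
  [set f : pattern n | (#|varying f| == d) && exact_copy H (trace_on d S f)]%SET.

Definition copy_fraction (R : realType) (d n : nat) (H : {set cube d})
    (S : {set cube n}) : R :=
  #|copies H S|%:R / ('C(n, d) * 2 ^ (n - d))%:R.

(* Since fractions are nonnegative, the initial value 0 does not affect the
   maximum. For [n < d] there are no subcubes and this is 0. *)
Definition max_copy_fraction (R : realType) (d : nat) (H : {set cube d})
    (n : nat) : R :=
  \big[Num.max/0]_(S : {set cube n}) copy_fraction R H S.

Definition cube_density (R : realType) (d : nat) (H : {set cube d}) : R :=
  limn (max_copy_fraction R H).

Definition vertex (n : nat) (s : n.-tuple bool) : cube n :=
  [ffun i => tnth s i].

Definition configZ : {set cube 4} :=
  [set vertex [tuple false; false; false; false];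
       vertex [tuple true; true; false; false];
       vertex [tuple true; false; true; false];
       vertex [tuple false; true; true; false]]%SET.

(* Main.v *)
Require Import Defs.
From mathcomp Require Import all_boot all_order all_fingroup all_algebra.
From mathcomp Require Import all_classical all_reals all_analysis.
From mathcomp Require Import zify ring lra.
From mathcomp Require Import fintype finset.
Import Order.TTheory GRing.Theory Num.Theory.
Import numFieldNormedType.Exports.
Local Open Scope ring_scope.

(** Why the density is 1/2.

    Upper bound.  Let S be a configuration in the n-cube and v any vertex, in S
    or not.  Join two directions i and j when the square spanned at v by i and j
    contains an odd number of points of S; this is the graph [face_parity S v]
    on the n directions.  The indicator of the configuration Z is, modulo 2, the
    product (1 + a + b + c)(1 + x), so at each of the sixteen vertices of the
    4-cube the graph of Z is the claw K_{1,3} with centre x and leaves a, b, c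
    ([configZ_claw]).  A cube automorphism maps squares to squares, so the same
    holds, up to renaming directions, for each exact copy of Z
    ([exact_copy_faces]).  Hence, if a sub-4-cube through v meets S in a copy of
    Z, its four directions induce a claw in [face_parity S v] ([copy_claw]), and
    the proportion of good subcubes among those through v is at most the density
    of induced claws in a graph on n vertices.  Averaging over v gives
    [copies_bound].

    The density of induced claws is at most 1/2 asymptotically ([claws_bound]).
    For an edge cx, the other two leaves of a claw with centre c and leaf x lie
    in N(c) \ N(x), a set of size at most min(d(c), n - d(x)).  Adding the
    squares of these sizes over both orientations of an edge yields at most
    (n^3 / 8)(1/d(c) + 1/d(x)) ([claw_edge_ineq]), and the sum of 1/d(c) + 1/d(x)
    over the edges is the number of vertices of positive degree.

    Lower bound.  Split the directions into two halves A and B, and take the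
    vertices with an even number of ones in A and an even number in B.  Each
    subcube with three free directions on one side and one on the other then
    meets this set in a copy of Z ([split31_copy]), and about half of the
    4-sets of directions are split in this way.

    Both bounds are made explicit, as 1/2 (1 - 5/n)^4 and 1/2 (1 - 3/n)^(-4), and
    the theorem follows by squeezing. *)

Set Implicit Arguments.
Unset Strict Implicit.
Unset Printing Implicit Defensive.

(** * Induced claws in a graph *)

Definition claw (T : finType) (e : rel T) (c x y z : T) : bool :=
  [&& e c x, e c y, e c z, ~~ e x y, ~~ e x z, ~~ e y z & uniq [:: x; y; z]].

(** Claws are counted as ordered quadruples, so that an induced claw on a given
    set of four vertices is counted six times. *)
Definition claws (T : finType) (e : rel T) : {set (T * T) * (T * T)} :=
  [set t | claw e t.1.1 t.1.2 t.2.1 t.2.2]%SET.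

(** Here p and q stand for the degrees of the ends of an edge, and a and b for
    the sizes of the two differences of neighbourhoods.  The weight 1/p at
    an end of degree p makes the total weight received from its edges equal to 1.
    When p + q <= n, the bounds a <= p and b <= q suffice, by the identity
    8pq(p^2 + q^2) = (p + q)^4 - (p - q)^4; when p + q > n, the bounds
    a <= n - q and b <= n - p are the binding ones. *)
Lemma claw_edge_ineq (F : realFieldType) (n p q a b : F) :
  0 < p -> 0 < q -> p <= n -> q <= n -> 0 <= a -> 0 <= b ->
  a <= p -> a <= n - q -> b <= q -> b <= n - p ->
  8 * (p * q * (a ^+ 2 + b ^+ 2)) <= n ^+ 3 * (p + q).
Proof.
move=> p0 q0 pn qn a0 b0 ap aq bq bp.
have p0' := ltW p0; have q0' := ltW q0.
have n0 : 0 < n by apply: lt_le_trans pn.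
have pq0 : 0 < p * q by apply: mulr_gt0.
case: (lerP (p + q) n) => [s_le|s_gt].
  have ab : a ^+ 2 + b ^+ 2 <= p ^+ 2 + q ^+ 2.
    by apply: lerD; rewrite ler_pXn2r ?nnegrE.
  apply: (@le_trans _ _ ((p + q) ^+ 4)).
    rewrite -subr_ge0.
    have -> : (p + q) ^+ 4 - 8 * (p * q * (a ^+ 2 + b ^+ 2)) =
      (p - q) ^+ 4 + 8 * (p * q * (p ^+ 2 + q ^+ 2 - (a ^+ 2 + b ^+ 2))) by ring.
    apply: addr_ge0; first by rewrite exprn_even_ge0.
    apply: mulr_ge0 => //; apply: mulr_ge0; first exact: ltW.
    by rewrite subr_ge0.
  rewrite [_ ^+ 4]exprSr; apply: ler_wpM2r; first exact: addr_ge0.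
  by rewrite ler_pXn2r ?nnegrE ?addr_ge0 ?(ltW n0).
(* With t the excess of p + q over n and P = pq, the bound on a^2 + b^2 is
   n^2 + t^2 - 2P, so the left-hand side is a concave quadratic in P. *)
set t := p + q - n.
have t0 : 0 < t by rewrite /t; lra.
have tn : t <= n by rewrite /t; lra.
have ab : a ^+ 2 + b ^+ 2 <= (n - q) ^+ 2 + (n - p) ^+ 2.
  by apply: lerD; rewrite ler_pXn2r ?nnegrE ?subr_ge0.
set P := p * q.
have Pt : n * t <= P.
  have : 0 <= (n - p) * (n - q) by rewrite mulr_ge0 // subr_ge0.
  by rewrite /P /t; nra.
apply: (@le_trans _ _ (8 * (P * (n ^+ 2 + t ^+ 2 - 2 * P)))).
  rewrite ler_pM2l // ler_pM2l //; apply: (le_trans ab).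
  by rewrite le_eqVlt; apply/orP; left; apply/eqP; rewrite /P /t; ring.
have -> : p + q = n + t by rewrite /t; ring.
(* For small t the maximum of the quadratic over all P is good enough.  For
   larger t, the constraint P >= nt lies beyond the vertex of the parabola, and
   the maximum is at P = nt.  The threshold 2n/5 lies in the range where both
   arguments work. *)
case: (lerP (5 * t) (2 * n)) => [tl|tg].
  rewrite -subr_ge0.
  have -> : n ^+ 3 * (n + t) - 8 * (P * (n ^+ 2 + t ^+ 2 - 2 * P)) =
    (n ^+ 2 + t ^+ 2 - 4 * P) ^+ 2 + t * (n ^+ 3 - t * (2 * n ^+ 2 + t ^+ 2)) by ring.
  apply: addr_ge0; first by rewrite sqr_ge0.
  apply: mulr_ge0; first exact: ltW.
  rewrite subr_ge0.
  apply: (@le_trans _ _ ((2 * n / 5) * (2 * n ^+ 2 + (2 * n / 5) ^+ 2))).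
    have tl' : t <= 2 * n / 5 by lra.
    apply: ler_pM => //; first exact: ltW.
      by apply: addr_ge0; [apply: mulr_ge0 => //|]; exact: sqr_ge0.
    rewrite lerD2l ler_pXn2r ?nnegrE ?(ltW t0) //; lra.
  by have := exprn_gt0 3 n0; nra.
have nt0 : 0 <= n * t by rewrite mulr_ge0 ?ltW.
apply: (@le_trans _ _ (8 * (n * t * (n ^+ 2 + t ^+ 2 - 2 * (n * t))))).
  rewrite ler_pM2l // -subr_ge0.
  have -> : n * t * (n ^+ 2 + t ^+ 2 - 2 * (n * t)) - P * (n ^+ 2 + t ^+ 2 - 2 * P)
   = (P - n * t) * (2 * (P - n * t) + (4 * (n * t) - n ^+ 2 - t ^+ 2)) by ring.
  apply: mulr_ge0; first by rewrite subr_ge0.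
  by apply: addr_ge0; [rewrite mulr_ge0 ?subr_ge0|nra].
have -> : 8 * (n * t * (n ^+ 2 + t ^+ 2 - 2 * (n * t))) = n * (8 * (t * (n - t) ^+ 2)) by ring.
have -> : n ^+ 3 * (n + t) = n * (n ^+ 2 * (n + t)) by ring.
rewrite ler_pM2l //.
(* This is the inequality t (n - t)^2 <= 4 n^3 / 27, an equality at t = n/3. *)
have : 0 <= (n - 3 * t) ^+ 2 * (4 * n - 3 * t).
  by apply: mulr_ge0; [exact: sqr_ge0|lra].
have : 0 <= n ^+ 2 * (5 * t - 2 * n).
  by apply: mulr_ge0; [exact: sqr_ge0|lra].
by have := exprn_gt0 3 n0; nra.
Qed.

Definition nbhd (T : finType) (e : rel T) (c : T) : {set T} := [set y | e c y]%SET.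

(** Once the centre c and the leaf x are chosen, each of the two other leaves is
    a neighbour of c that is not a neighbour of x. *)
Lemma claws_le_edge_sum (T : finType) (e : rel T) :
  (#|claws e| <= \sum_(p : T * T | e p.1 p.2) #|nbhd e p.1 :\: nbhd e p.2| ^ 2)%N.
Proof.
rewrite -sum1_card (partition_big fst (fun p => e p.1 p.2)) /=; last first.
  by move=> t; rewrite inE => /and5P[].
apply: leq_sum => p _; rewrite sum1dep_card.
set A := _ :\: _.
apply: (@leq_trans #|setX [set p] (setX A A)|); last by rewrite !cardsX cards1 mul1n mulnn.
apply/subset_leq_card/subsetP => -[[c x] [y z]]; rewrite !inE /claw /=.
case/andP => /and5P[_ cy cz xy /andP[xz _]] /eqP <- /=.
by rewrite eqxx xy xz cy cz.
Qed.

(** Each non-isolated vertex c contributes d(c) terms 1/d(c). *)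
Lemma sum_inv_degree (F : numFieldType) (T : finType) (e : rel T) :
  \sum_(p : T * T | e p.1 p.2) (#|nbhd e p.1|%:R : F)^-1 <= #|T|%:R.
Proof.
rewrite -(pair_big_dep xpredT e (fun c _ => (#|nbhd e c|%:R)^-1)) /=.
rewrite -sum1_card natr_sum; apply: ler_sum => c _.
rewrite sumr_const.
have -> : #|e c| = #|nbhd e c| by apply: eq_card => y; rewrite !inE.
have [->|nz] := eqVneq #|nbhd e c| 0%N; first by rewrite mulr0n.
by rewrite -[_ *+ _]mulr_natl mulfV // pnatr_eq0.
Qed.

(** The constant is sharp: in the complete bipartite graph with equal parts there
    are asymptotically n^4 / 8 ordered claws. *)
Lemma claws_bound (T : finType) (e : rel T) :
  symmetric e -> (8 * #|claws e| <= #|T| ^ 4)%N.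
Proof.
move=> esym; set n := #|T|.
have -> : (8 * #|claws e| <= n ^ 4)%N = (8 * #|claws e|%:R <= n%:R ^+ 4 :> rat).
  by rewrite -natrX -(natrM _ 8) ler_nat.
pose d c : rat := #|nbhd e c|%:R.
pose a (p : T * T) : rat := #|nbhd e p.1 :\: nbhd e p.2|%:R.
pose sw (p : T * T) := (p.2, p.1).
have swI : forall F : T * T -> rat,
    \sum_(p : T * T | e p.1 p.2) F p = \sum_(p : T * T | e p.1 p.2) F (sw p).
  move=> F; rewrite (reindex_inj (h := sw)) /=; last by move=> [? ?] [? ?] [-> ->].
  by apply: eq_bigl => p; rewrite esym.
have le1 : #|claws e|%:R <= \sum_(p : T * T | e p.1 p.2) a p ^+ 2.
  apply: (le_trans (y := (\sum_(p : T * T | e p.1 p.2) #|nbhd e p.1 :\: nbhd e p.2| ^ 2)%:R)).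
    by rewrite ler_nat claws_le_edge_sum.
  by rewrite natr_sum; apply: ler_sum => p _; rewrite natrX.
have dn c : d c <= n%:R by rewrite ler_nat max_card.
have a_ge0 p : 0 <= a p by rewrite ler0n.
have ad p : a p <= d p.1 by rewrite ler_nat subset_leq_card // subsetDl.
have an p : a p <= n%:R - d p.2.
  rewrite lerBrDr -natrD ler_nat -cardsUI.
  rewrite [X in (_ + X)%N](_ : _ = 0%N) ?addn0 ?max_card //.
  by apply/eqP; rewrite cards_eq0 setDE -setIA [~: _ :&: _]setIC setICr setI0.
(* The bound concerns the two orientations of an edge together, hence the
   symmetrization by sw. *)
have edge p : e p.1 p.2 ->
    8 * (a p ^+ 2 + a (sw p) ^+ 2) <= n%:R ^+ 3 * ((d p.1)^-1 + (d p.2)^-1).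
  move=> ep.
  have d1 : 0 < d p.1 by rewrite ltr0n card_gt0; apply/set0Pn; exists p.2; rewrite inE.
  have d2 : 0 < d p.2 by rewrite ltr0n card_gt0; apply/set0Pn; exists p.1; rewrite inE esym.
  have := claw_edge_ineq d1 d2 (dn _) (dn _) (a_ge0 p) (a_ge0 (sw p)) (ad _) (an _) (ad (sw p)) (an (sw p)) => h.
  rewrite -(ler_pM2l (mulr_gt0 d1 d2)).
  have -> : d p.1 * d p.2 * (n%:R ^+ 3 * ((d p.1)^-1 + (d p.2)^-1)) = n%:R ^+ 3 * (d p.1 + d p.2).
    by field; rewrite !gt_eqF.
  by apply: le_trans h; rewrite mulrCA.
have inv2 : \sum_(p : T * T | e p.1 p.2) (d p.2)^-1 = \sum_(p : T * T | e p.1 p.2) (d p.1)^-1 by rewrite swI.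
have /(_ (index_enum _)) := ler_sum _ edge.
rewrite -!mulr_sumr !big_split /= -(swI (fun p => a p ^+ 2)) inv2.
have le2 : \sum_(p : T * T | e p.1 p.2) (d p.1)^-1 <= n%:R.
  exact: sum_inv_degree.
have n3 : 0 <= n%:R ^+ 3 :> rat by rewrite exprn_ge0.
have := ler_wpM2l n3 le2; rewrite -exprSr mulrDr; lra.
Qed.

(** * Parities of S on squares *)

Lemma claw_inj (T T' : finType) (e : rel T) (e' : rel T') (p : T -> T') c x y z :
  injective p -> (forall i j, e' (p i) (p j) = e i j) ->
  claw e' (p c) (p x) (p y) (p z) = claw e c x y z.
Proof.
by move=> pI pe; rewrite /claw !pe (map_inj_uniq pI [:: x; y; z]).
Qed.

Definition flip (n : nat) (u : cube n) (i : 'I_n) : cube n :=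
  [ffun k => u k (+) (k == i)].

Lemma flipK n (u : cube n) i : flip (flip u i) i = u.
Proof. by apply/ffunP => k; rewrite !ffunE -addbA addbb addbF. Qed.

Lemma flipC n (u : cube n) i j : flip (flip u i) j = flip (flip u j) i.
Proof. by apply/ffunP => k; rewrite !ffunE addbAC. Qed.

Lemma flip_inj n (u : cube n) : injective (flip u).
Proof.
by move=> i j /ffunP/(_ i); rewrite !ffunE eqxx => /addbI/esym/eqP.
Qed.

Lemma adj_flip n (u : cube n) i : cube_adj u (flip u i).
Proof.
rewrite /cube_adj -(cards1 i); apply/eqP/eq_card => k.
by rewrite !inE ffunE; case: (u k); case: (k == i).
Qed.

Lemma adjP n (u v : cube n) : cube_adj u v -> exists i, v = flip u i.
Proof.
case/cards1P => i /setP uv; exists i; apply/ffunP => k.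
by have := uv k; rewrite !inE ffunE => <-; case: (u k); case: (v k).
Qed.

(** Two vertices at distance two span a unique square, so the fourth vertex of
    the square is determined by the other three. *)
Lemma common_neighbor n (u : cube n) i j k l : i != j ->
  flip (flip u i) k = flip (flip u j) l -> k = i \/ k = j.
Proof.
move=> nij E; have [->|nkj] := eqVneq k j; first by right.
have /ffunP/(_ j) := E; rewrite !ffunE eqxx (eq_sym j i) (eq_sym j k) (negPf nij) (negPf nkj).
case: (eqVneq j l) => [jl _|_]; last by case: (u j).
by left; apply: (@flip_inj _ (flip u i)); rewrite E -jl !flipK.
Qed.

(** A cube automorphism permutes the directions at each vertex u, and as it maps
    squares to squares, the permutation at u also describes its effect at
    distance two.  The permutation does not depend on u, but a local statement is
    all that square parities require. *)
Lemma aut_flip n (s : {perm cube n}) (u : cube n) : cube_aut s ->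
  exists p : 'I_n -> 'I_n, [/\ injective p,
    forall i, s (flip u i) = flip (s u) (p i) &
    forall i j, s (flip (flip u i) j) = flip (flip (s u) (p i)) (p j)].
Proof.
move=> /forallP aut.
have flipS (w : cube n) i : exists k, s (flip w i) = flip (s w) k.
  by apply: adjP; have /forallP/(_ (flip w i))/eqP -> := aut w; exact: adj_flip.
have [p sp] := choice (flipS u).
have pI : injective p.
  by move=> i j pij; apply: (@flip_inj _ u); apply: (@perm_inj _ s); rewrite !sp pij.
exists p; split => // i j.
have [->|nij] := eqVneq i j; first by rewrite !flipK.
have npij : p i != p j by rewrite (inj_eq pI).
have [k sk] := flipS (flip u i) j; have [l sl] := flipS (flip u j) i.
rewrite sk sp; rewrite sp in sk; rewrite sp in sl.
case: (@common_neighbor _ (s u) (p i) (p j) k l npij) => [|ki|-> //].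
  by rewrite -sk -sl flipC.
move: sk; rewrite ki flipK => /perm_inj; rewrite -{2}(flipK u i) => /flip_inj ji.
by rewrite ji eqxx in nij.
Qed.

(** This is the mixed second derivative of the indicator of S over the field with
    two elements, in the directions i and j. *)
Definition face_parity (n : nat) (S : {set cube n}) (v : cube n) : rel 'I_n :=
  fun i j => (v \in S) (+) (flip v i \in S) (+) (flip v j \in S) (+)
             (flip (flip v i) j \in S).

Lemma face_parityC n (S : {set cube n}) v : symmetric (face_parity S v).
Proof. by move=> i j; rewrite /face_parity flipC; congr (_ (+) _); rewrite addbAC. Qed.

Lemma exact_copy_faces n (H K : {set cube n}) (w : cube n) : exact_copy H K ->
  exists u, exists p : 'I_n -> 'I_n, injective p /\
    forall i j, face_parity K w (p i) (p j) = face_parity H u i j.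
Proof.
case/existsP => s /andP[aut /eqP <-].
exists ((s^-1)%g w); have [p [pI p1 p2]] := aut_flip ((s^-1)%g w) aut.
rewrite permKV in p1 p2.
exists p; split => // i j; rewrite /face_parity -p2 -!p1 -{1}(permKV s w).
by rewrite !(mem_imset _ _ (@perm_inj _ s)).
Qed.

Local Notation "o '#'" := (@Ordinal 4 o isT) (at level 1).

Lemma mem_configZ (u : cube 4) :
  (u \in configZ) = ~~ u (3#) && ~~ (u (0#) (+) u (1#) (+) u (2#)).
Proof.
have uE a b c d : (u == vertex [tuple a; b; c; d]) =
    [&& u (0#) == a, u (1#) == b, u (2#) == c & u (3#) == d].
  apply/eqP/and4P => [->|[/eqP ua /eqP ub /eqP uc /eqP ud]].
    by rewrite !ffunE !(tnth_nth false).
  apply/ffunP => -[[|[|[|[|//]]]] lt]; rewrite ffunE (tnth_nth false) /= -?ua -?ub -?uc -?ud;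
  by congr (u _); apply: val_inj.
rewrite !inE !uE.
by case: (u (0#)); case: (u (1#)); case: (u (2#)); case: (u (3#)).
Qed.

(** The directions 0, 1, 2 span the facet carrying Z, and 3 is the direction
    orthogonal to it.  A square inside a facet parallel to this one contains 0 or
    2 points of Z, whereas a square using direction 3 contains exactly one. *)
Lemma configZ_claw (u : cube 4) :
  claw (face_parity configZ u) (3#) (0#) (1#) (2#).
Proof.
rewrite /claw /face_parity !mem_configZ !ffunE /= andbT.
by case: (u (0#)); case: (u (1#)); case: (u (2#)); case: (u (3#)).
Qed.

(** * Counting the copies of Z through a vertex *)

(** The coordinate of the ambient cube that becomes the k-th coordinate of the
    subcube f after its identification with the d-cube. *)
Definition dir d n (f : pattern n) (fd : #|varying f| = d) (k : 'I_d) : 'I_n :=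
  enum_val (cast_ord (esym fd) k).

Lemma dir_inj d n (f : pattern n) (fd : #|varying f| = d) : injective (dir fd).
Proof. by move=> i j /enum_val_inj /cast_ord_inj. Qed.

Lemma dir_varying d n (f : pattern n) (fd : #|varying f| = d) k : dir fd k \in varying f.
Proof. exact: enum_valP. Qed.

Lemma varying_dir d n (f : pattern n) (fd : #|varying f| = d) i :
  i \in varying f -> exists k, i = dir fd k.
Proof.
move=> iv; exists (cast_ord fd (enum_rank_in iv i)).
by rewrite /dir cast_ordK enum_rankK_in.
Qed.

Lemma to_cubeE d n (f : pattern n) (fd : #|varying f| = d) (v : cube n) k :
  to_cube d f v k = v (dir fd k).
Proof.
rewrite ffunE (nth_map (dir fd k)); first by rewrite [in RHS]/dir (enum_val_nth (dir fd k)).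
by rewrite -cardE fd.
Qed.

Lemma subcubeP n (f : pattern n) (v : cube n) :
  reflect (forall i, i \notin varying f -> f i = Some (v i)) (v \in subcube f).
Proof.
rewrite inE; apply: (iffP forallP) => vf i.
  by have := vf i; case: (i \in _) => //= /eqP.
by case: (boolP (i \in _)) => //= /vf ->.
Qed.

Lemma to_cube_inj d n (f : pattern n) : #|varying f| = d ->
  {in subcube f &, injective (to_cube d f)}.
Proof.
move=> fd u v /subcubeP uf /subcubeP vf uv; apply/ffunP => i.
have [/(varying_dir fd)[k ->]|iv] := boolP (i \in varying f).
  by rewrite -!to_cubeE uv.
by have := uf _ iv; rewrite vf // => -[].
Qed.

Lemma to_cube_surj d n (f : pattern n) (w : cube d) : #|varying f| = d ->
  exists2 v, v \in subcube f & to_cube d f v = w.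
Proof.
move=> fd.
exists [ffun i => if [pick k | dir fd k == i] is Some k then w k else odflt false (f i)].
  apply/subcubeP => i; rewrite ffunE; case: pickP => [k /eqP <-|_].
    by rewrite dir_varying.
  by rewrite inE; case: (f i).
apply/ffunP => k; rewrite to_cubeE ffunE; case: pickP => [l /eqP/dir_inj -> //|/(_ k)].
by rewrite eqxx.
Qed.

Lemma card_subcube n (f : pattern n) : #|subcube f| = (2 ^ #|varying f|)%N.
Proof.
rewrite -(card_in_imset (to_cube_inj (erefl #|varying f|))).
rewrite (_ : _ @: _ = [set: cube #|varying f|])%SET.
  by rewrite cardsT card_ffun card_bool card_ord.
apply/setP => w; rewrite inE; have [v vf <-] := to_cube_surj w (erefl #|varying f|).
exact: imset_f.
Qed.

Lemma flip_subcube n (f : pattern n) (v : cube n) i :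
  i \in varying f -> v \in subcube f -> flip v i \in subcube f.
Proof.
move=> iv /subcubeP vf; apply/subcubeP => j jv; rewrite ffunE vf //.
by case: eqP jv => [->|]; rewrite ?iv ?addbF.
Qed.

Lemma to_cube_flip d n (f : pattern n) (fd : #|varying f| = d) (v : cube n) k :
  to_cube d f (flip v (dir fd k)) = flip (to_cube d f v) k.
Proof.
by apply/ffunP => l; rewrite to_cubeE !ffunE -to_cubeE ffunE (inj_eq (@dir_inj _ _ _ fd)).
Qed.

Lemma mem_trace d n (S : {set cube n}) (f : pattern n) v : #|varying f| = d ->
  v \in subcube f -> (to_cube d f v \in trace_on d S f) = (v \in S).
Proof.
move=> fd vf; apply/imsetP/idP => [[u /setIP[uS uf]]|vS].
  by move/(to_cube_inj fd vf uf) ->.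
by exists v; rewrite // inE vS.
Qed.

Lemma face_parity_trace d n (S : {set cube n}) (f : pattern n) (fd : #|varying f| = d) (v : cube n) i j :
  v \in subcube f ->
  face_parity (trace_on d S f) (to_cube d f v) i j = face_parity S v (dir fd i) (dir fd j).
Proof.
move=> vf; rewrite /face_parity -!to_cube_flip.
by rewrite !mem_trace // ?flip_subcube ?dir_varying.
Qed.

(** Square parities of the trace are those of S itself ([face_parity_trace]), so
    the claw that Z has at each of its sixteen vertices is visible at each vertex
    v of the subcube. *)
Lemma copy_claw n (S : {set cube n}) f v : f \in copies configZ S -> v \in subcube f ->
  exists c x y z, claw (face_parity S v) c x y z /\
    varying f = [set i in [:: c; x; y; z]]%SET.
Proof.
rewrite inE => /andP[/eqP fd Zf] vf.
have [u [p [pI pZ]]] := exact_copy_faces (to_cube 4 f v) Zf.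
pose q := dir fd \o p; have qI : injective q by apply: inj_comp pI; exact: dir_inj.
exists (q (3#)), (q (0#)), (q (1#)), (q (2#)); split.
  rewrite (claw_inj _ _ _ _ (e := face_parity configZ u)) ?configZ_claw // => i j.
  by rewrite -face_parity_trace ?pZ.
apply/esym/eqP; rewrite eqEcard fd; apply/andP; split.
  apply/subsetP => i; rewrite inE.
  by case/(@mapP _ _ q [:: 3#; 0#; 1#; 2#]) => k _ ->; exact: dir_varying.
have uq : uniq [:: q (3#); q (0#); q (1#); q (2#)].
  by apply: (etrans (map_inj_uniq qI [:: 3#; 0#; 1#; 2#])).
by rewrite cardsE (card_uniqP uq).
Qed.

(** The subcube through v with set of directions D. *)
Definition pattern_at n (v : cube n) (D : {set 'I_n}) : pattern n :=
  [ffun i => if i \in D then None else Some (v i)].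

Lemma pattern_at_varying n (f : pattern n) v :
  v \in subcube f -> pattern_at v (varying f) = f.
Proof.
move=> /subcubeP vf; apply/ffunP => i; rewrite ffunE.
by case: ifPn => [|/vf //]; rewrite inE => /eqP.
Qed.

Definition claw_vertices (T : finType) (t : (T * T) * (T * T)) : {set T} :=
  [set i in [:: t.1.1; t.1.2; t.2.1; t.2.2]]%SET.

Lemma six_claws (T : finType) (e : rel T) c x y z : symmetric e -> claw e c x y z ->
  (6 <= #|[set t in claws e | claw_vertices t == [set i in [:: c; x; y; z]]]%SET|)%N.
Proof.
move=> es cl.
have /and5P[cx cy cz nxy /and3P[nxz nyz]] := cl.
rewrite /= !inE andbT negb_or => /andP[/andP[xy xz] yz].
pose s := [:: ((c, x), (y, z)); ((c, x), (z, y)); ((c, y), (x, z));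
              ((c, y), (z, x)); ((c, z), (x, y)); ((c, z), (y, x))].
have us : uniq s.
  rewrite /= !inE !xpair_eqE !eqxx ?(negPf xy) ?(negPf xz) ?(negPf yz) /=.
  by rewrite ?(eq_sym y x) ?(eq_sym z x) ?(eq_sym z y) ?(negPf xy) ?(negPf xz) ?(negPf yz).
rewrite -[6%N]/(size s) -(card_uniqP us); apply/subset_leq_card/subsetP => t.
have nyx : ~~ e y x by rewrite es.
have nzx : ~~ e z x by rewrite es.
have nzy : ~~ e z y by rewrite es.
rewrite !inE => /or4P[/eqP->|/eqP->|/eqP->|/or3P[]/eqP->] /=;
 apply/andP; split; try by [rewrite /claw /= ?cx ?cy ?cz ?nxy ?nxz ?nyz ?nyx ?nzx ?nzy
   /= !inE ?(eq_sym y x) ?(eq_sym z x) ?(eq_sym z y) ?(negPf xy) ?(negPf xz) ?(negPf yz)];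
 by apply/eqP/setP => i; rewrite !inE /=; do 4 case: (i == _).
Qed.

(** A subcube through v is determined by its set of directions, which supports at
    least the six orderings of the leaves of one claw. *)
Lemma copies_through n (S : {set cube n}) v :
  (6 * #|[set f in copies configZ S | v \in subcube f]%SET| <= #|claws (face_parity S v)|)%N.
Proof.
rewrite -sum1_card big_distrr /= muln1.
rewrite -[leqRHS]sum1_card.
rewrite (partition_big (fun t => pattern_at v (claw_vertices t)) xpredT) //=.
rewrite [leqRHS](bigID (mem [set f in copies configZ S | v \in subcube f]%SET)) /=.
apply: leq_trans (leq_addr _ _); apply: leq_sum => f.
rewrite inE => /andP[fZ vf].
have [c [x [y [z [cl fE]]]]] := copy_claw fZ vf.
rewrite sum1dep_card; apply: leq_trans (six_claws (@face_parityC _ S v) cl) _.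
apply/subset_leq_card/subsetP => t; rewrite !inE => /andP[-> /eqP ->] /=.
by rewrite -fE pattern_at_varying.
Qed.

(** Double counting of the pairs (v, f) with v a vertex of the good subcube f:
    each f has 16 vertices, each pair accounts for 6 claws, and a graph on n
    vertices has at most n^4 / 8 of them; 768 is 16 * 6 * 8. *)
Lemma copies_bound n (S : {set cube n}) :
  (768 * #|copies configZ S| <= 2 ^ n * n ^ 4)%N.
Proof.
have -> : (768 * #|copies configZ S| =
    \sum_(v : cube n) 8 * (6 * #|[set f in copies configZ S | v \in subcube f]%SET|))%N.
  rewrite -!big_distrr /= mulnA -[768%N]/(48 * 16)%N -mulnA; congr (_ * _)%N.
  under eq_bigr do rewrite -sum1dep_card.
  rewrite (exchange_big_dep (mem (copies configZ S))) /=; last by move=> ? ? _ /andP[].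
  rewrite -sum1_card big_distrr /=; apply: eq_bigr => f fZ.
  rewrite muln1; under eq_bigl do rewrite fZ.
  rewrite sum1_card card_subcube.
  by move: fZ; rewrite inE => /andP[/eqP -> _].
apply: (@leq_trans (\sum_(v : cube n) n ^ 4)).
  apply: leq_sum => v _; apply: (@leq_trans (8 * #|claws (face_parity S v)|)).
    by rewrite leq_pmul2l // copies_through.
  by have := claws_bound (@face_parityC _ S v); rewrite card_ord.
by rewrite sum_nat_const card_ffun card_bool card_ord.
Qed.

(** * A set with many copies of Z *)

Definition parity n (A : {set 'I_n}) (v : cube n) : bool :=
  \big[addb/false]_(i in A) v i.

Definition even_even n (A : {set 'I_n}) : {set cube n} :=
  [set v | ~~ parity A v && ~~ parity (~: A) v]%SET.

Lemma parity_I4 (F : 'I_4 -> bool) :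
  \big[addb/false]_(k | k != 3#) F k = F (0#) (+) F (1#) (+) F (2#).
Proof.
rewrite (bigD1 (0#)) //= (bigD1 (1#)) //= (bigD1 (2#)) //= big1 ?addbF ?addbA //.
by move=> [[|[|[|[|//]]]] lt].
Qed.

Lemma shuffle_aut n (s : {perm 'I_n}) (c : cube n) (t : {perm cube n}) :
  (forall w k, t w (s k) = w k (+) c k) -> cube_aut t.
Proof.
move=> tE; apply/forallP => u; apply/forallP => v; apply/eqP.
rewrite /cube_adj; congr (_ == _).
rewrite -[RHS](card_imset _ (@perm_inj _ s)); apply: eq_card => k.
rewrite -(permKV s k) mem_imset ?inE ?tE; last exact: perm_inj.
by case: (u _) (v _) (c _) => [] [] [].
Qed.

(** All the sets cut out by one coordinate and by the parity of the three others
    are copies of Z.  Exchanging coordinate j with the last one and translating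
    by b in that coordinate and by a in the three others carries Z to the set:
    three translations by a change the parity of the three coordinates by a. *)
Lemma configZ_copy (K : {set cube 4}) (j : 'I_4) (a b : bool) :
  (forall w, (w \in K) = (w j == b) && (parity [set~ j]%SET w == a)) ->
  exact_copy configZ K.
Proof.
move=> KE; pose s : {perm 'I_4} := tperm j (3#).
pose c : cube 4 := [ffun k => if k == 3# then b else a].
pose h (w : cube 4) : cube 4 := [ffun k => w (s k) (+) c (s k)].
have hI : injective h.
  move=> u v /ffunP uv; apply/ffunP => k; have := uv (s k).
  by rewrite !ffunE !tpermK => /addIb.
have hE w k : perm hI w (s k) = w k (+) c k by rewrite permE !ffunE tpermK.
apply/existsP; exists (perm hI); rewrite (shuffle_aut hE) /=.
apply/eqP/setP => w; rewrite -(permKV (perm hI) w) mem_imset; last exact: perm_inj.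
set u := ((perm hI)^-1)%g w.
rewrite mem_configZ KE.
have -> : perm hI u j = u (3#) (+) b by rewrite -{1}(tpermR j (3#)) hE ffunE eqxx.
have -> : parity [set~ j]%SET (perm hI u) = \big[addb/false]_(k | k != 3#) (u k (+) a).
  rewrite /parity (reindex_inj (@perm_inj _ s)) /=; apply: eq_big => k.
    by rewrite !inE -{1}(tpermR j (3#)) (inj_eq perm_inj).
  by rewrite !inE -{1}(tpermR j (3#)) (inj_eq perm_inj) hE ffunE => /negPf ->.
rewrite parity_I4; case: (u (0#)); case: (u (1#)); case: (u (2#)); case: (u (3#));
 by case: a {KE c h hI hE u}; case: b.
Qed.

(** The fixed coordinates contribute a constant, so on a subcube a parity
    condition is again a parity condition. *)
Lemma parity_trace d n (A : {set 'I_n}) (f : pattern n) (fd : #|varying f| = d) v :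
  v \in subcube f ->
  parity A v = parity [set k | dir fd k \in A]%SET (to_cube d f v)
    (+) \big[addb/false]_(i in A | i \notin varying f) odflt false (f i).
Proof.
move=> /subcubeP vf; rewrite /parity (bigID (mem (varying f))) /=; congr (_ (+) _); last first.
  by apply: eq_bigr => i /andP[_ /vf ->].
rewrite (eq_bigl (mem (dir fd @: [set k | dir fd k \in A]%SET))%SET); last first.
  move=> i /=; apply/andP/imsetP => [[iA /(varying_dir fd)[k ik]]|[k]].
    by exists k; rewrite // inE -ik.
  by rewrite inE => kA ->; rewrite dir_varying.
rewrite big_imset /=; last by move=> ? ? _ _; exact: dir_inj.
by apply: eq_bigr => k _; rewrite to_cubeE.
Qed.

Lemma even_evenC n (A : {set 'I_n}) : even_even (~: A) = even_even A.
Proof. by apply/setP => v; rewrite !inE setCK andbC. Qed.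

(** Evenness outside A fixes the value of the single free coordinate there, and
    evenness on A fixes the parity of the three others. *)
Lemma split31_copy n (A : {set 'I_n}) (f : pattern n) :
  #|varying f :&: A| = 3%N -> #|varying f :&: ~: A| = 1%N ->
  f \in copies configZ (even_even A).
Proof.
move=> c3 c1.
have fd : #|varying f| = 4%N by rewrite -(cardsID A) setDE c3 c1.
rewrite inE fd eqxx /=.
have /eqP/cards1P[i iE] := c1.
have /setIP[iv iA] : i \in varying f :&: ~: A by rewrite iE inE.
have [j ij] := varying_dir fd iv.
have jE : [set k | dir fd k \in ~: A]%SET = [set j]%SET.
  apply/setP => k; rewrite [LHS]inE [RHS]inE.
  have := dir_varying fd k; move/setP/(_ (dir fd k)): iE.
  by rewrite [LHS]inE [RHS]inE ij (inj_eq (@dir_inj _ _ _ fd)) => <- ->.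
have jE' : [set k | dir fd k \in A]%SET = [set~ j]%SET.
  by apply/setP => k; move/setP/(_ k): jE; rewrite !inE => <-; rewrite negbK.
pose r (B : {set 'I_n}) := \big[addb/false]_(i in B | i \notin varying f) odflt false (f i).
apply: (@configZ_copy _ j (r A) (r (~: A))) => w.
have [v vf <-] := to_cube_surj w fd.
rewrite mem_trace // inE !(parity_trace _ fd vf) -/(r _) -/(r _) jE jE' {2}/parity big_set1.
by rewrite andbC; do 2![case: (r _)]; case: (to_cube _ _ _ _); case: (parity _ _).
Qed.

(** Patterns varying exactly on D are the functions with None-support the
    complement of D and values other than None there. *)
Lemma card_pattern_varying n (D : {set 'I_n}) :
  #|[set f : pattern n | varying f == D]%SET| = (2 ^ (n - #|D|))%N.
Proof.
have -> : (n - #|D|)%N = #|~: D| by rewrite [RHS]cardsCs setCK card_ord.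
have <- : #|predC1 (@None bool)| = 2%N by rewrite cardC1 card_option card_bool.
rewrite -(card_pffun_on None); apply: eq_card => f; rewrite inE.
apply/eqP/pffun_onP => [<-|[fD fR]].
  split; first by apply/subsetP => i; rewrite !inE.
  by move=> _ /imageP[i + ->]; rewrite !inE.
apply/setP => i; rewrite inE; apply/idP/idP => [fi|iD].
  apply: contraT => niD; have := fR (f i); rewrite !inE fi; apply.
  by apply/imageP; exists i; rewrite // inE.
by apply: contraT => fi; have /(subsetP fD) : i \in None.-support f by []; rewrite inE iD.
Qed.

Lemma card_split_sets n (A : {set 'I_n}) p q :
  ('C(#|A|, p) * 'C(#|~: A|, q) <=
   #|[set D : {set 'I_n} | (#|D :&: A| == p) && (#|D :&: ~: A| == q)]%SET|)%N.
Proof.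
rewrite -!cards_draws -cardsX.
set X := setX _ _.
pose g (P : {set 'I_n} * {set 'I_n}) := P.1 :|: P.2.
have gE P : P \in X -> [/\ g P :&: A = P.1, g P :&: ~: A = P.2, #|P.1| = p & #|P.2| = q].
  rewrite !inE => /andP[/andP[s1 /eqP ->] /andP[s2 /eqP ->]]; split => //.
    rewrite setIUl (setIidPl s1) (_ : P.2 :&: A = set0) ?setU0 //.
    by apply/eqP; rewrite setI_eq0 -(setCK A) -subsets_disjoint.
  rewrite setIUl (setIidPl s2) (_ : P.1 :&: ~: A = set0) ?set0U //.
  by apply/eqP; rewrite setI_eq0 -subsets_disjoint.
rewrite -(card_in_imset (f := g)).
  apply/subset_leq_card/subsetP => _ /imsetP[P PX ->].
  by rewrite inE; have [-> -> -> ->] := gE _ PX; rewrite !eqxx.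
move=> P Q /gE[P1 P2 _ _] /gE[Q1 Q2 _ _] PQ.
by rewrite [P]surjective_pairing [Q]surjective_pairing -P1 -P2 -Q1 -Q2 PQ.
Qed.

(** The two families of good 4-sets of directions are those split 3 + 1 and
    1 + 3 by A; each set supports 2 ^ (n - 4) parallel subcubes. *)
Lemma card_copies_even_even n (A : {set 'I_n}) :
  (('C(#|A|, 3) * #|~: A| + #|A| * 'C(#|~: A|, 3)) * 2 ^ (n - 4)
     <= #|copies configZ (even_even A)|)%N.
Proof.
pose G p q := [set D : {set 'I_n} | (#|D :&: A| == p) && (#|D :&: ~: A| == q)]%SET.
have disj : [disjoint G 3%N 1%N & G 1%N 3%N].
  rewrite disjoints_subset; apply/subsetP => D; rewrite !inE => /andP[/eqP -> _].
  by [].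
apply: (@leq_trans (#|G 3%N 1%N :|: G 1%N 3%N| * 2 ^ (n - 4))).
  rewrite leq_mul2r; apply/orP; right; rewrite cardsU disjoint_setI0 // cards0 subn0.
  by apply: leq_add; [have := card_split_sets A 3 1|have := card_split_sets A 1 3];
    rewrite bin1.
rewrite -sum_nat_const.
rewrite -[leqRHS]sum1_card (partition_big (@varying n) xpredT) //=.
rewrite [leqRHS](bigID (mem (G 3%N 1%N :|: G 1%N 3%N))) /=.
apply: leq_trans (leq_addr _ _); apply: leq_sum => D DG.
rewrite sum1dep_card.
have D4 : #|D| = 4%N.
  by move: DG; rewrite -(cardsID A D) setDE !inE => /orP[]/andP[/eqP-> /eqP->].
have := card_pattern_varying D; rewrite D4 => <-.
apply/subset_leq_card/subsetP => f; rewrite inE => /eqP fD.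
rewrite inE fD eqxx andbT; move: DG; rewrite -fD !inE => /orP[]/andP[/eqP h1 /eqP h2].
  by have := split31_copy h1 h2; rewrite inE.
have h3 : #|varying f :&: ~: ~: A| = 1%N by rewrite setCK.
by have := split31_copy h2 h3; rewrite even_evenC inE.
Qed.

(** * Explicit bounds and the limit *)

Lemma subn_pow_leq_ffact n k : ((n - k.-1) ^ k <= n ^_ k)%N.
Proof.
case: k => // k /=; elim: k n => [|k IH] [|n] //; rewrite ?ffactn1 ?subn0 ?expn1 //.
by rewrite ffactnS expnS subSS leq_mul // leqW ?leq_subr.
Qed.

Lemma ffact_leq_pow n k : (n ^_ k <= n ^ k)%N.
Proof.
elim: k n => [|k IH] n //; rewrite ffactnS expnS leq_mul2l.
apply/orP; right; apply: leq_trans (IH _) _.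
by case: (k) => // j; rewrite leq_exp2r // leq_pred.
Qed.

Lemma copies_upper n (S : {set cube n}) : (4 <= n)%N ->
  (2 * #|copies configZ S| * (n - 3) ^ 4 <= n ^ 4 * ('C(n, 4) * 2 ^ (n - 4)))%N.
Proof.
move=> n4; have := copies_bound S.
have -> : (2 ^ n = 16 * 2 ^ (n - 4))%N by rewrite -(expnD 2 4) subnKC.
rewrite -[768%N]/(16 * 48)%N -[(16 * 48 * _)%N]mulnA -[(16 * _ * _)%N]mulnA leq_pmul2l // => h.
have := subn_pow_leq_ffact n 4; rewrite -bin_ffact /= => h2.
apply: (@leq_trans (2 * #|copies configZ S| * ('C(n, 4) * 4`!))).
  by rewrite leq_mul2l h2 orbT.
rewrite mulnCA; apply: (@leq_trans ('C(n, 4) * (48 * #|copies configZ S|))).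
  by rewrite -[4`!]/24%N; lia.
by rewrite [leqRHS]mulnCA leq_mul2l [(n ^ 4 * _)%N]mulnC h orbT.
Qed.

(** With A a half of the directions, both 3 + 1 and 1 + 3 splits number at least
    m^4 / 6 for m = floor(n/2) - 2. *)
Lemma copies_lower n : exists S : {set cube n},
  ((n - 5) ^ 4 * ('C(n, 4) * 2 ^ (n - 4)) <= 2 * #|copies configZ S| * n ^ 4)%N.
Proof.
pose A : {set 'I_n} := [set i : 'I_n | (i < n./2)%N]%SET.
have cA : #|A| = n./2.
  have le : (n./2 <= n)%N by lia.
  have wI : injective (widen_ord le) by move=> i j /(congr1 val) ij; apply: val_inj.
  rewrite -[RHS]card_ord -(card_imset _ wI).
  apply: eq_card => i; rewrite inE; apply/idP/imsetP => [lt|[k _ ->]]; last exact: (ltn_ord k).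
  by exists (Ordinal lt) => //; apply: val_inj.
have cB : #|~: A| = (n - n./2)%N by rewrite [LHS]cardsCs setCK cA card_ord.
exists (even_even A); have := card_copies_even_even A; rewrite cA cB.
set a := n./2; set b := (n - a)%N => h.
set N := #|_| in h *.
set m := (a - 2)%N.
have mb : (m <= b - 2)%N by rewrite /m /b /a; lia.
have ab : (n - 5 <= 2 * m)%N by rewrite /m /a; lia.
have c3 k : ((k - 2) ^ 3 <= 6 * 'C(k, 3))%N.
  by have := subn_pow_leq_ffact k 3; rewrite -bin_ffact mulnC.
have c4 : (24 * 'C(n, 4) <= n ^ 4)%N.
  by have := ffact_leq_pow n 4; rewrite -bin_ffact mulnC.
have p1 : (m ^ 4 <= 6 * ('C(a, 3) * b))%N.
  rewrite mulnA expnSr; apply: leq_mul; first exact: c3.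
  exact: leq_trans mb (leq_subr _ _).
have p2 : (m ^ 4 <= 6 * (a * 'C(b, 3)))%N.
  rewrite mulnCA expnS; apply: leq_mul; first exact: leq_subr.
  by apply: leq_trans (c3 b); rewrite leq_exp2r.
have p3 : ((n - 5) ^ 4 <= 48 * ('C(a, 3) * b + a * 'C(b, 3)))%N.
  apply: (@leq_trans ((2 * m) ^ 4)); first by rewrite leq_exp2r.
  by rewrite expnMn -[(2 ^ 4)%N]/16%N; lia.
apply: (@leq_trans (48 * ('C(a, 3) * b + a * 'C(b, 3)) * ('C(n, 4) * 2 ^ (n - 4)))).
  by rewrite leq_mul2r p3 orbT.
apply: (@leq_trans (2 * (('C(a, 3) * b + a * 'C(b, 3)) * 2 ^ (n - 4)) * n ^ 4)); last first.
  by rewrite leq_mul2r leq_mul2l h !orbT.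
set X := (_ + _)%N; set Y := (2 ^ _)%N.
have -> : (48 * X * ('C(n, 4) * Y) = 2 * (X * Y) * (24 * 'C(n, 4)))%N by lia.
by rewrite leq_mul2l c4 orbT.
Qed.

Lemma max_fraction_upper (R : realType) n : (4 <= n)%N ->
  max_copy_fraction R configZ n <= 2^-1 * (1 - 3 * n%:R^-1) ^- 4.
Proof.
move=> n4.
have n0 : 0 < n%:R :> R by rewrite ltr0n (leq_trans _ n4).
have n3 : 3 < n%:R :> R by rewrite ltr_nat.
have -> : (1 - 3 * n%:R^-1) ^- 4 = n%:R ^+ 4 / (n%:R - 3) ^+ 4 :> R.
  by field; rewrite !gt_eqF ?subr_gt0.
apply: bigmax_le => [|S _].
  by rewrite mulr_ge0 ?invr_ge0 // divr_ge0 // exprn_ge0 // subr_ge0 ltW.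
have := copies_upper S n4; rewrite /copy_fraction -(ler_nat R) !natrM !natrX natrB 1?ltnW //.
move=> h.
have P0 : 0 < 'C(n, 4)%:R * 2%:R ^+ (n - 4) :> R.
  by rewrite mulr_gt0 ?exprn_gt0 // ltr0n bin_gt0.
have Q0 : 0 < (n%:R - 3) ^+ 4 :> R by rewrite exprn_gt0 // subr_gt0.
rewrite ler_pdivrMr // mulrAC mulrA ler_pdivlMr //.
by move: h; lra.
Qed.

Lemma max_fraction_lower (R : realType) n : (5 <= n)%N ->
  2^-1 * (1 - 5 * n%:R^-1) ^+ 4 <= max_copy_fraction R configZ n.
Proof.
move=> n5; have [S] := copies_lower n.
have n0 : 0 < n%:R :> R by rewrite ltr0n (leq_trans _ n5).
rewrite -(ler_nat R) !natrM !natrX natrB // => h.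
apply: (le_trans _ (le_bigmax _ _ S)).
rewrite /copy_fraction natrM natrX.
have P0 : 0 < 'C(n, 4)%:R * 2%:R ^+ (n - 4) :> R.
  by rewrite mulr_gt0 ?exprn_gt0 // ltr0n bin_gt0 ltnW.
have -> : (1 - 5 * n%:R^-1) ^+ 4 = (n%:R - 5) ^+ 4 / n%:R ^+ 4 :> R.
  by field; rewrite gt_eqF.
rewrite ler_pdivlMr // [2^-1 * (_ / _)]mulrA [_ * ('C(n, 4)%:R * _)]mulrAC.
rewrite ler_pdivrMr ?exprn_gt0 //.
by move: h; lra.
Qed.

Local Open Scope classical_set_scope.

Lemma cvg_one_sub_div (R : realType) (c : R) :
  (fun n : nat => 1 - c * n%:R^-1) @ \oo --> (1 : R).
Proof.
have inv0 : (fun n : nat => n%:R^-1) @ \oo --> (0 : R).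
  by rewrite -cvg_shiftS; exact: cvg_harmonic.
have := cvgB (cvg_cst (1 : R)) (cvgM (cvg_cst c) inv0).
by rewrite mulr0 subr0; apply.
Qed.

Theorem theorem8p4 (R : realType) :
  cvgn (max_copy_fraction R configZ) /\ cube_density R configZ = 1 / 2.
Proof.
have lower : (fun n : nat => 2^-1 * (1 - 5 * n%:R^-1) ^+ 4) @ \oo --> (2^-1 * 1 ^+ 4 : R).
  apply: cvgM; first exact: cvg_cst.
  exact: continuous_cvg (@exprn_continuous R 4 1) (cvg_one_sub_div 5).
have upper : (fun n : nat => 2^-1 * (1 - 3 * n%:R^-1) ^- 4) @ \oo --> (2^-1 * 1 ^- 4 : R).
  apply: cvgM; first exact: cvg_cst.
  apply: cvgV; first by rewrite expr1n oner_neq0.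
  exact: continuous_cvg (@exprn_continuous R 4 1) (cvg_one_sub_div 3).
rewrite expr1n mulr1 in lower; rewrite expr1n invr1 mulr1 in upper.
have lim : max_copy_fraction R configZ @ \oo --> (2^-1 : R).
  apply: squeeze_cvgr lower upper.
  near=> n; have n5 : (5 <= n)%N by near: n; exact: nbhs_infty_ge.
  by rewrite max_fraction_lower // max_fraction_upper // ltnW.
by split; [exact: cvgP lim|rewrite /cube_density (cvg_lim _ lim) // div1r].
Unshelve. all: by end_near.
Qed.
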